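(* Let $\alpha\in\mathbb{C}$ with $\alpha\neq 0,-1$, and let $C_\alpha$ be the 3-dimensional complex $\omega$-Lie algebra with basis $\{x,y,z\}$, bracket determined by $[x,y]=y$, $[x,z]=\alpha z$, $[y,z]=x$, and form $\omega$ determined by $\omega(x,y)=\omega(x,z)=0$, $\omega(y,z)=1+\alpha$. Then any finite-dimensional irreducible $C_\alpha$-module is 1-dimensional.
   Context: An $\omega$-Lie algebra over $\mathbb{C}$ is a triple $(\mathfrak{g},[-,-],\omega)$ where $\mathfrak{g}$ is a finite-dimensional complex vector space, $[-,-]$ is a skew-symmetric bilinear bracket on $\mathfrak{g}$ and $\omega:\mathfrak{g}\times\mathfrak{g}\to\mathbb{C}$ is a skew-symmetric bilinear form such that $$[[x,y],z]+[[y,z],x]+[[z,x],y]=\omega(x,y)z+\omega(y,z)x+\omega(z,x)y$$ for all $x,y,z\in\mathfrak{g}$. A finite-dimensional complex vector space $V$ is a $\mathfrak{g}$-module if there is a bilinear map $\mathfrak{g}\times V\to V$, $(x,v)\mapsto x\cdot v$, such that $[x,y]\cdot v=x\cdot(y\cdot v)-y\cdot(x\cdot v)+\omega(x,y)v$ for all $x,y\in\mathfrak{g}$ and $v\in V$. A submodule is a linear subspace stable under the action of every element of $\mathfrak{g}$. A nonzero $\mathfrak{g}$-module $V$ is irreducible if its only submodules are $\{0\}$ and $V$. *)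

(* Defs.v *)
From HB Require Import structures.
From mathcomp Require Import all_boot all_order all_algebra.
From mathcomp Require Import ring complex reals.

Set Implicit Arguments.
Unset Strict Implicit.
Unset Printing Implicit Defensive.

Import Order.TTheory GRing.Theory Num.Theory.
Local Open Scope ring_scope.

Record omegaLieAlgebra (K : fieldType) := OmegaLieAlgebra {
  olie_space :> vectType K;
  olie_bracket : {bilinear olie_space -> olie_space -> olie_space};
  olie_form : {biscalar olie_space};
  olie_bracketC : forall x y, olie_bracket x y = - olie_bracket y x;
  olie_formC : forall x y, olie_form x y = - olie_form y x;
  olie_jacobi : forall x y z,
    olie_bracket (olie_bracket x y) z
    + olie_bracket (olie_bracket y z) x
    + olie_bracket (olie_bracket z x) y
    = olie_form x y *: z + olie_form y z *: x + olie_form z x *: y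
}.

Record omegaLieModule (K : fieldType) (g : omegaLieAlgebra K) :=
  OmegaLieModule {
  omod_space :> vectType K;
  omod_act : {bilinear g -> omod_space -> omod_space};
  omod_bracket : forall (x y : g) (v : omod_space),
    omod_act (olie_bracket g x y) v
    = omod_act x (omod_act y v) - omod_act y (omod_act x v)
      + olie_form g x y *: v
}.

Definition is_submodule (K : fieldType) (g : omegaLieAlgebra K)
    (V : omegaLieModule g) (W : {vspace V}) : Prop :=
  forall (x : g) (v : V), v \in W -> omod_act V x v \in W.

Definition irreducible_module (K : fieldType) (g : omegaLieAlgebra K)
    (V : omegaLieModule g) : Prop :=
  (exists v : V, v != 0) /\
  forall W : {vspace V}, is_submodule W -> W = 0%VS \/ W = fullv.

Definition is_C_alpha (K : fieldType) (alpha : K) (g : omegaLieAlgebra K)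
    (x y z : g) : Prop :=
  [/\ basis_of fullv [:: x; y; z],
      [/\ olie_bracket g x y = y,
          olie_bracket g x z = alpha *: z
        & olie_bracket g y z = x]
    & [/\ olie_form g x y = 0,
          olie_form g x z = 0
        & olie_form g y z = 1 + alpha]].

(* The presentation [is_C_alpha] is realized, for every alpha, on row vectors
   of coordinates in the basis (x, y, z). *)
Section Existence.
Variables (K : fieldType) (alpha : K).
Let V := 'rV[K]_3.
Let i0 : 'I_3 := @Ordinal 3 0 isT.
Let i1 : 'I_3 := @Ordinal 3 1 isT.
Let i2 : 'I_3 := @Ordinal 3 2 isT.

Definition C_alpha_bracket (u v : V) : V :=
  (u 0 i1 * v 0 i2 - u 0 i2 * v 0 i1) *: delta_mx 0 i0
  + (u 0 i0 * v 0 i1 - u 0 i1 * v 0 i0) *: delta_mx 0 i1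
  + (alpha * (u 0 i0 * v 0 i2 - u 0 i2 * v 0 i0)) *: delta_mx 0 i2.

Definition C_alpha_form (u v : V) : K :=
  (1 + alpha) * (u 0 i1 * v 0 i2 - u 0 i2 * v 0 i1).

Let rowP3 (u v : V) :
  u 0 i0 = v 0 i0 -> u 0 i1 = v 0 i1 -> u 0 i2 = v 0 i2 -> u = v.
Proof.
move=> h0 h1 h2; apply/rowP => -[[|[|[|//]]] hi].
- by rewrite (_ : Ordinal hi = i0) //; apply: val_inj.
- by rewrite (_ : Ordinal hi = i1) //; apply: val_inj.
- by rewrite (_ : Ordinal hi = i2) //; apply: val_inj.
Qed.

Let C_alpha_bracket_bilinear :
  bilinear_for (GRing.Scale.Law.clone _ _ *:%R _)
               (GRing.Scale.Law.clone _ _ *:%R _) C_alpha_bracket.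
Proof.
by split=> w c u v /=; apply: rowP3; rewrite /C_alpha_bracket !mxE /=; ring.
Qed.

HB.instance Definition _ := bilinear_isBilinear.Build K V V V _ _
  C_alpha_bracket C_alpha_bracket_bilinear.

Let C_alpha_form_bilinear :
  bilinear_for (GRing.Scale.Law.clone _ _ *%R _)
               (GRing.Scale.Law.clone _ _ *%R _) C_alpha_form.
Proof. by split=> w c u v /=; rewrite /C_alpha_form !mxE /=; ring. Qed.

HB.instance Definition _ := bilinear_isBilinear.Build K V V K _ _
  C_alpha_form C_alpha_form_bilinear.

Lemma C_alpha_exists :
  exists (g : omegaLieAlgebra K) (x y z : g), is_C_alpha alpha x y z.
Proof.
have bC u v : C_alpha_bracket u v = - C_alpha_bracket v u.
  by apply: rowP3; rewrite /C_alpha_bracket !mxE /=; ring.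
have fC u v : C_alpha_form u v = - C_alpha_form v u.
  by rewrite /C_alpha_form; ring.
have J u v w :
    C_alpha_bracket (C_alpha_bracket u v) w
    + C_alpha_bracket (C_alpha_bracket v w) u
    + C_alpha_bracket (C_alpha_bracket w u) v
    = C_alpha_form u v *: w + C_alpha_form v w *: u + C_alpha_form w u *: v.
  by apply: rowP3; rewrite /C_alpha_bracket /C_alpha_form !mxE /=; ring.
exists (@OmegaLieAlgebra K V C_alpha_bracket C_alpha_form bC fC J).
exists (delta_mx 0 i0 : V), (delta_mx 0 i1 : V), (delta_mx 0 i2 : V).
split.
- rewrite basisEdim /=; apply/andP; split; last by rewrite dimvf /dim /= mul1n.
  apply/subvP => u _.
  have -> : u = u 0 i0 *: delta_mx 0 i0 + u 0 i1 *: delta_mx 0 i1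
                + u 0 i2 *: delta_mx 0 i2.
    by apply: rowP3; rewrite !mxE /=; ring.
  by rewrite !memvD ?memvZ // memv_span // !inE eqxx ?orbT.
- by split; apply: rowP3; rewrite /= /C_alpha_bracket !mxE /=; ring.
- by split; rewrite /= /C_alpha_form !mxE /=; ring.
Qed.

End Existence.

(* Main.v *)
Require Import Defs.
From mathcomp Require Import all_boot all_order all_algebra.
From mathcomp Require Import complex reals.
Set Implicit Arguments.
Unset Strict Implicit.
Unset Printing Implicit Defensive.
Import Order.TTheory GRing.Theory Num.Theory.
Local Open Scope ring_scope.

(** Write X, Y, Z for the operators by which x, y, z act on a module. The
    module axiom reads
      XY - YX = Y,   XZ - ZX = alpha Z,   YZ - ZY = X - (1 + alpha).
    The commutator [Y, Z] can be moved across X in two ways. Since ad X is a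
    derivation, the first two relations give [X, [Y, Z]] = (1 + alpha) [Y, Z];
    but by the third one [Y, Z] is X minus a scalar, which commutes with X.
    As alpha <> -1, this forces [Y, Z] = 0, that is X = 1 + alpha
    ([C_alpha_act_x], the heart of the proof). A scalar X commutes with Y and Z,
    so the first two relations now give Y = 0 and, as alpha <> 0, Z = 0. Hence
    every element of the algebra acts on the module by a scalar
    ([C_alpha_act_scalar]), every line is a submodule, and an irreducible module
    is a line. *)

Section CAlphaModule.
Variables (K : fieldType) (alpha : K).
Hypotheses (alpha_neq0 : alpha != 0) (alpha_neqN1 : alpha != -1).
Variables (g : omegaLieAlgebra K) (x y z : g).
Hypothesis g_C_alpha : is_C_alpha alpha x y z.
Variable V : omegaLieModule g.

Local Notation act := (omod_act V).

Lemma C_alpha_act_xy v : act x (act y v) = act y (act x v) + act y v.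
Proof.
have [_ [xy _ _] [wxy _ _]] := g_C_alpha.
have := omod_bracket x y v; rewrite xy wxy scale0r addr0 => /esym/eqP.
by rewrite subr_eq addrC => /eqP.
Qed.

Lemma C_alpha_act_xz v :
  act x (act z v) = act z (act x v) + alpha *: act z v.
Proof.
have [_ [_ xz _] [_ wxz _]] := g_C_alpha.
have := omod_bracket x z v; rewrite xz wxz scale0r addr0 linearZl_LR => /esym/eqP.
by rewrite subr_eq addrC => /eqP.
Qed.

Lemma C_alpha_act_yz v :
  act y (act z v) - act z (act y v) = act x v - (1 + alpha) *: v.
Proof.
have [_ [_ _ yz] [_ _ wyz]] := g_C_alpha.
by have := omod_bracket y z v; rewrite yz wyz => ->; rewrite addrK.
Qed.

(** Substituting X - (1 + alpha) for [Y, Z] in the derivation identity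
    [X, [Y, Z]] = (1 + alpha) [Y, Z] kills the left-hand side and leaves
    (1 + alpha) (X - (1 + alpha)) = 0. *)
Lemma C_alpha_act_x v : act x v = (1 + alpha) *: v.
Proof.
have adX_YZ : act x (act y (act z v) - act z (act y v)) =
    act y (act z (act x v)) - act z (act y (act x v)) +
    (1 + alpha) *: (act y (act z v) - act z (act y v)).
  rewrite linearB /= C_alpha_act_xy !C_alpha_act_xz C_alpha_act_xy.
  rewrite !linearD !linearZ /=.
  by rewrite !scalerDl !scale1r !addrA [LHS](AC 6 (1*4*3*2*5*6)).
move: adX_YZ; rewrite !C_alpha_act_yz linearB linearZ /=.
rewrite -[LHS]addr0 => /addrI/esym/eqP; rewrite scaler_eq0 subr_eq0.
by rewrite addrC addr_eq0 (negPf alpha_neqN1) /= addrC => /eqP.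
Qed.

Lemma C_alpha_act_y v : act y v = 0.
Proof.
have := C_alpha_act_xy v; rewrite !C_alpha_act_x linearZ /=.
by rewrite -[LHS]addr0 => /addrI.
Qed.

Lemma C_alpha_act_z v : act z v = 0.
Proof.
have := C_alpha_act_xz v; rewrite !C_alpha_act_x linearZ /=.
rewrite -[LHS]addr0 => /addrI/esym/eqP.
by rewrite scaler_eq0 (negPf alpha_neq0) => /eqP.
Qed.

Lemma C_alpha_act_scalar u : exists c : K, forall v, act u v = c *: v.
Proof.
have [xyz_basis _ _] := g_C_alpha.
have : u \in <<[:: x; y; z]>>%VS by rewrite (span_basis xyz_basis) memvf.
rewrite !span_cons span_nil addv0.
case/memv_addP => _ /vlineP[a ->] [_ /memv_addP[_ /vlineP[b ->]
  [_ /vlineP[c ->] ->]] ->].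
exists (a * (1 + alpha)) => v.
rewrite !linearDl !linearZl_LR /= C_alpha_act_x C_alpha_act_y C_alpha_act_z.
by rewrite !scaler0 !addr0 scalerA.
Qed.

Lemma C_alpha_submodule (W : {vspace V}) : is_submodule W.
Proof.
move=> u v vW; have [c ->] := C_alpha_act_scalar u.
exact: memvZ.
Qed.

Lemma dim_irreducible_C_alpha_module :
  irreducible_module V -> \dim (fullv : {vspace V}) = 1%N.
Proof.
case=> -[v v_neq0] /(_ <[v]>%VS (@C_alpha_submodule _))[line0 | <-].
  by have := dim_vline v; rewrite line0 dimv0 v_neq0.
by rewrite dim_vline v_neq0.
Qed.

End CAlphaModule.

Theorem theorem7p1 (R : realType) (alpha : R[i])
    (alpha_neq0 : alpha != 0) (alpha_neqN1 : alpha != -1)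
    (g : omegaLieAlgebra R[i]) (x y z : g)
    (g_C_alpha : is_C_alpha alpha x y z)
    (V : omegaLieModule g) (V_irr : irreducible_module V) :
  \dim (fullv : {vspace V}) = 1%N.
Proof.
exact: (dim_irreducible_C_alpha_module alpha_neq0 alpha_neqN1 g_C_alpha).
Qed.
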